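(* Let $1\le k\le n$, and let $\hat\sigma$ be any one of the choices $\hat\sigma_I,\hat\sigma_S,\hat\sigma_G$. The operator $s_k=s_k(\sigma)$ is self-adjoint in $H_{\mathbf h}$ (for both choices $\sigma^{(k)}=\sigma$ and $\sigma^{(k)}=\tilde\sigma^{(k)}$). Moreover: 1. For $\sigma^{(k)}=\sigma$, the operator $s_k$ is non-singular in $H_{\mathbf h}$ provided that $$\frac{2-\delta_{i_k,1}}{12}\,\frac{\sigma_{\mathbf i}}{\hat\sigma_{\mathbf i-0.5\mathbf e_k}}+\frac{2-\delta_{i_k,N_k-1}}{12}\,\frac{\sigma_{\mathbf i}}{\hat\sigma_{\mathbf i+0.5\mathbf e_k}}\le1\quad\text{for any } x_{\mathbf i}\in\omega_{\mathbf h},$$ and, for each fixed choice of the indices $i_l$, $1\le l\le n$, $l\ne k$ (with $1\le i_l\le N_l-1$), the inequality is strict for at least one value of $i_k=1,\dots,N_k-1$, where $\delta_{i,j}$ is the Kronecker symbol. 2. For $\sigma^{(k)}=\tilde\sigma^{(k)}$, one has $\beta^{(k)}_{\mathbf i}=5\big(\alpha^{(k)}_{\mathbf i}+\alpha^{(k)}_{\mathbf i+\mathbf e_k}\big)$ for all $x_{\mathbf i}\in\omega_{\mathbf h}$, and consequently the operator $s_k$ is positive definite (thus, non-singular) in $H_{\mathbf h}$.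
   Context: Let $n\ge1$, $\Omega=(0,X_1)\times\dots\times(0,X_n)$, and let $\sigma(x)>0$ be a given smooth function on $\bar\Omega$. Mesh: for each $l$, $h_l=X_l/N_l$ with integer $N_l\ge2$; the nodes are $x_{\mathbf i}=(i_1h_1,\dots,i_nh_n)$, $\mathbf i=(i_1,\dots,i_n)$. The mesh $\bar\omega_{\mathbf h}$ consists of the nodes with $0\le i_l\le N_l$ for all $l$, $\omega_{\mathbf h}$ consists of the nodes with $1\le i_l\le N_l-1$ for all $l$, and $\partial\omega_{\mathbf h}=\bar\omega_{\mathbf h}\setminus\omega_{\mathbf h}$. $\mathbf e_1,\dots,\mathbf e_n$ is the canonical basis of $\mathbb R^n$, $w_{\mathbf i}=w(x_{\mathbf i})$, and $x_{\mathbf i-0.5\mathbf e_k}=x_{\mathbf i}-0.5h_k\mathbf e_k$. Mean values: $\hat\sigma_{\mathbf i-0.5\mathbf e_k}$ denotes one of (the same choice throughout) - $\hat\sigma_{I(\mathbf i-0.5\mathbf e_k)}=\frac1{h_k}\int_{(i_k-1)h_k}^{i_kh_k}\sigma\,dx_k$ (the other coordinates being fixed equal to those of $x_{\mathbf i}$), - $\hat\sigma_{S(\mathbf i-0.5\mathbf e_k)}=\frac16\big(\sigma(x_{\mathbf i-\mathbf e_k})+4\sigma(x_{\mathbf i-0.5\mathbf e_k})+\sigma(x_{\mathbf i})\big)$, - $\hat\sigma_{G(\mathbf i-0.5\mathbf e_k)}=\frac12\big(\sigma(x_{\mathbf i-0.5\mathbf e_k}-\theta_Gh_k\mathbf e_k)+\sigma(x_{\mathbf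 i-0.5\mathbf e_k}+\theta_Gh_k\mathbf e_k)\big)$, $\theta_G=\frac1{2\sqrt3}$, and $\hat\sigma_{\mathbf i+0.5\mathbf e_k}=\hat\sigma_{(\mathbf i+\mathbf e_k)-0.5\mathbf e_k}$. The coefficient $\sigma^{(k)}$ is either $\sigma^{(k)}_{\mathbf i}=\sigma_{\mathbf i}$ or $$\sigma^{(k)}_{\mathbf i}=\tilde\sigma^{(k)}_{\mathbf i}=\Big[\frac12\Big(\frac1{\hat\sigma_{\mathbf i-0.5\mathbf e_k}}+\frac1{\hat\sigma_{\mathbf i+0.5\mathbf e_k}}\Big)\Big]^{-1}.$$ The operator $s_k=s_k(\sigma)$: for $x_{\mathbf i}\in\omega_{\mathbf h}$, $$s_k(\sigma)w_{\mathbf i}=\frac1{\sigma^{(k)}_{\mathbf i}}w_{\mathbf i}+\frac{h_k^2}{12}\Lambda_k(\sigma)w_{\mathbf i},\qquad \Lambda_k(\sigma)w_{\mathbf i}=\frac1{h_k}\Big(\frac{w_{\mathbf i+\mathbf e_k}-w_{\mathbf i}}{\hat\sigma_{\mathbf i+0.5\mathbf e_k}h_k}-\frac{w_{\mathbf i}-w_{\mathbf i-\mathbf e_k}}{\hat\sigma_{\mathbf i-0.5\mathbf e_k}h_k}\Big),$$ equivalently $s_k(\sigma)w_{\mathbf i}=\alpha^{(k)}_{\mathbf i}w_{\mathbf i-\mathbf e_k}+\beta^{(k)}_{\mathbf i}w_{\mathbf i}+\alpha^{(k)}_{\mathbf i+\mathbf e_k}w_{\mathbf i+\mathbf e_k}$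 with $$\alpha^{(k)}_{\mathbf i}=\frac1{12\,\hat\sigma_{\mathbf i-0.5\mathbf e_k}},\qquad \beta^{(k)}_{\mathbf i}=\frac1{\sigma^{(k)}_{\mathbf i}}-\alpha^{(k)}_{\mathbf i}-\alpha^{(k)}_{\mathbf i+\mathbf e_k}.$$ $H_{\mathbf h}$ is the Euclidean space of real functions $w$ on $\bar\omega_{\mathbf h}$ with $w|_{\partial\omega_{\mathbf h}}=0$, with inner product $(w,z)_{H_{\mathbf h}}=\sum_{x_{\mathbf i}\in\omega_{\mathbf h}}w_{\mathbf i}z_{\mathbf i}h_1\cdots h_n$. As an operator in $H_{\mathbf h}$, $s_k$ is given by the formula above on $\omega_{\mathbf h}$, and $s_kw$ is set to $0$ on $\partial\omega_{\mathbf h}$. *)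

(* Defs.v *)
From HB Require Import structures.
From mathcomp Require Import all_boot all_order all_algebra.
From mathcomp Require Import all_classical all_reals all_analysis.

Set Implicit Arguments.
Unset Strict Implicit.
Unset Printing Implicit Defensive.

Import Order.TTheory GRing.Theory Num.Theory.
Import numFieldNormedType.Exports.

Local Open Scope classical_set_scope.
Local Open Scope ring_scope.

Definition open_box (R : realType) (n : nat) (X : 'I_n -> R) :
    set 'rV[R]_n :=
  [set x | forall l, 0 < x ord0 l < X l].

Definition closed_box (R : realType) (n : nat) (X : 'I_n -> R) :
    set 'rV[R]_n :=
  [set x | forall l, 0 <= x ord0 l <= X l].

(* C^oo up to the boundary: all iterated partial derivatives exist in the open
   box and extend continuously to the closed box.  D s is the (extended)
   derivative of f in the directions listed in s, the head of s being
   differentiated last. *)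
Definition smooth_on_closed_box (R : realType) (n : nat) (X : 'I_n -> R)
    (f : 'rV[R]_n -> R) : Prop :=
  exists D : seq 'I_n -> 'rV[R]_n -> R,
    [/\ D [::] = f,
        forall s, {within closed_box X, continuous (D s)} &
        forall s l x, open_box X x ->
          is_derive x (delta_mx ord0 l) (D s) (D (l :: s) x)].

(* Multi-indices (i_1, ..., i_n) with 0 <= i_l <= N_l; coordinates are counted
   from 0, so l : 'I_n. *)
Definition node (n : nat) (N : 'I_n -> nat) : finType :=
  {dffun forall l : 'I_n, 'I_(N l).+1}.

Definition inner_nodes (n : nat) (N : 'I_n -> nat) : {set node N} :=
  [set i : node N | [forall l, (1 <= i l <= (N l).-1)%N]].

(* i + e_k and i - e_k.  They are the intended nodes only when i_k < N_k,
   respectively 0 < i_k; otherwise the value is irrelevant and never used on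
   inner nodes. *)
Definition node_succ (n : nat) (N : 'I_n -> nat) (k : 'I_n)
    (i : node N) : node N :=
  [ffun l : 'I_n => inord (i l + (l == k))%N : 'I_(N l).+1].

Definition node_pred (n : nat) (N : 'I_n -> nat) (k : 'I_n)
    (i : node N) : node N :=
  [ffun l : 'I_n => inord (i l - (l == k))%N : 'I_(N l).+1].

Definition mesh_step (R : realType) (n : nat) (X : 'I_n -> R) (N : 'I_n -> nat)
    (l : 'I_n) : R :=
  X l / (N l)%:R.

Definition node_point (R : realType) (n : nat) (X : 'I_n -> R) (N : 'I_n -> nat)
    (i : node N) : 'rV[R]_n :=
  \row_l ((i l)%:R * mesh_step X N l).

(* x_(i - 0.5 e_k) *)
Definition half_point (R : realType) (n : nat) (X : 'I_n -> R)
    (N : 'I_n -> nat) (k : 'I_n) (i : node N) : 'rV[R]_n :=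
  node_point X i - (mesh_step X N k / 2) *: delta_mx ord0 k.

Definition set_coord (R : realType) (n : nat) (x : 'rV[R]_n) (k : 'I_n)
    (t : R) : 'rV[R]_n :=
  \row_l (if l == k then t else x ord0 l).

Inductive mean_kind := MeanIntegral | MeanSimpson | MeanGauss.

Definition theta_G (R : realType) : R := 1 / (2 * Num.sqrt 3).

(* The mean value at i - 0.5 e_k (meaningful for 1 <= i_k <= N_k); the one at
   i + 0.5 e_k is its value at node_succ k i. *)
Definition hat (R : realType) (n : nat) (X : 'I_n -> R) (N : 'I_n -> nat)
    (sigma : 'rV[R]_n -> R) (m : mean_kind) (k : 'I_n) (i : node N) : R :=
  let h := mesh_step X N k in
  let y := half_point X k i in
  match m with
  | MeanIntegral =>
      1 / h * \int[lebesgue_measure]_(t in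
                 `[((i k)%:R - 1) * h, (i k)%:R * h])
                 sigma (set_coord (node_point X i) k t)
  | MeanSimpson =>
      1 / 6 * (sigma (node_point X (node_pred k i)) + 4 * sigma y + sigma (node_point X i))
  | MeanGauss =>
      1 / 2 * (sigma (y - (theta_G R * h) *: delta_mx ord0 k)
               + sigma (y + (theta_G R * h) *: delta_mx ord0 k))
  end.

Inductive coef_kind := CoefNodal | CoefHarmonic.

(* sigma^(k)_i *)
Definition coef (R : realType) (n : nat) (X : 'I_n -> R) (N : 'I_n -> nat)
    (sigma : 'rV[R]_n -> R) (m : mean_kind) (c : coef_kind) (k : 'I_n)
    (i : node N) : R :=
  match c with
  | CoefNodal => sigma (node_point X i)
  | CoefHarmonic =>
      (1 / 2 * (1 / hat X sigma m k i + 1 / hat X sigma m k (node_succ k i)))^-1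
  end.

Definition alpha (R : realType) (n : nat) (X : 'I_n -> R) (N : 'I_n -> nat)
    (sigma : 'rV[R]_n -> R) (m : mean_kind) (k : 'I_n) (i : node N) : R :=
  1 / (12 * hat X sigma m k i).

Definition beta (R : realType) (n : nat) (X : 'I_n -> R) (N : 'I_n -> nat)
    (sigma : 'rV[R]_n -> R) (m : mean_kind) (c : coef_kind) (k : 'I_n)
    (i : node N) : R :=
  1 / coef X sigma m c k i - alpha X sigma m k i
  - alpha X sigma m k (node_succ k i).

Definition Lambda (R : realType) (n : nat) (X : 'I_n -> R) (N : 'I_n -> nat)
    (sigma : 'rV[R]_n -> R) (m : mean_kind) (k : 'I_n)
    (w : {ffun node N -> R}) (i : node N) : R :=
  let h := mesh_step X N k in
  1 / h * ((w (node_succ k i) - w i) / (hat X sigma m k (node_succ k i) * h)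
           - (w i - w (node_pred k i)) / (hat X sigma m k i * h)).

Definition s_op (R : realType) (n : nat) (X : 'I_n -> R) (N : 'I_n -> nat)
    (sigma : 'rV[R]_n -> R) (m : mean_kind) (c : coef_kind) (k : 'I_n)
    (w : {ffun node N -> R}) : {ffun node N -> R} :=
  [ffun i : node N =>
     if i \in inner_nodes N then
       1 / coef X sigma m c k i * w i
       + mesh_step X N k ^+ 2 / 12 * Lambda X sigma m k w i
     else 0].

Definition Hh (R : realType) (n : nat) (N : 'I_n -> nat) :
    {pred {ffun node N -> R}} :=
  [pred w : {ffun node N -> R} |
    [forall i, (i \notin inner_nodes N) ==> (w i == 0)]].

Definition inner (R : realType) (n : nat) (X : 'I_n -> R) (N : 'I_n -> nat)
    (w z : {ffun node N -> R}) : R :=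
  \sum_(i in inner_nodes N) w i * z i * \prod_l mesh_step X N l.

Definition self_adjoint (R : realType) (n : nat) (X : 'I_n -> R)
    (N : 'I_n -> nat) (A : {ffun node N -> R} -> {ffun node N -> R}) : Prop :=
  {in @Hh R n N, forall w, A w \in @Hh R n N} /\
  {in @Hh R n N &, forall w z, inner X (A w) z = inner X w (A z)}.

Definition nonsingular (R : realType) (n : nat) (N : 'I_n -> nat)
    (A : {ffun node N -> R} -> {ffun node N -> R}) : Prop :=
  {in @Hh R n N, forall w, A w \in @Hh R n N} /\
  {in @Hh R n N, forall z, exists! w, w \in @Hh R n N /\ A w = z}.

Definition positive_definite (R : realType) (n : nat) (X : 'I_n -> R)
    (N : 'I_n -> nat) (A : {ffun node N -> R} -> {ffun node N -> R}) : Prop :=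
  {in @Hh R n N, forall w, w != 0 -> 0 < inner X (A w) w}.

(* A bound on this quantity by 1 amounts to diagonal dominance, in direction k,
   of s_k with the nodal coefficient; the Kronecker symbols drop boundary
   neighbours, where w = 0. *)
Definition dominance (R : realType) (n : nat) (X : 'I_n -> R)
    (N : 'I_n -> nat) (sigma : 'rV[R]_n -> R) (m : mean_kind) (k : 'I_n)
    (i : node N) : R :=
  (2 - (nat_of_ord (i k) == 1%N)%:R) / 12
    * (sigma (node_point X i) / hat X sigma m k i)
  + (2 - (nat_of_ord (i k) == (N k).-1)%:R) / 12
    * (sigma (node_point X i) / hat X sigma m k (node_succ k i)).

(* Main.v *)
Require Import Defs.
From HB Require Import structures.
From mathcomp Require Import all_boot all_order all_algebra.
From mathcomp Require Import all_classical all_reals all_analysis.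
From mathcomp Require Import ring lra zify.

Set Implicit Arguments.
Unset Strict Implicit.
Unset Printing Implicit Defensive.

Import Order.TTheory GRing.Theory Num.Theory.
Import numFieldNormedType.Exports.

Local Open Scope classical_set_scope.
Local Open Scope ring_scope.

(** In direction k the operator s_k is tridiagonal with off-diagonal entries
    alpha, and the edge between i - e_k and i carries the same entry alpha_i
    seen from either end; this symmetry is the self-adjointness
    ([tridiag_self_adjoint]).

    Both non-singularity claims come from one sum of squares
    ([tridiag_form]).  Let c_i be the sum of the off-diagonal entries linking i
    to inner neighbours.  Since 2 w_(i-e_k) w_i is the square of
    w_(i-e_k) + w_i minus the two squares, for w vanishing on the boundary
      sum_i (s_k w)_i w_i = sum_i (beta_i - c_i) w_i ^ 2
                          + sum_edges alpha_i (w_(i-e_k) + w_i) ^ 2.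
    The entries alpha are positive because each mean value of a positive
    continuous function is positive ([hat_gt0]).  If c_i <= beta_i everywhere,
    the form is thus nonnegative, and when it vanishes w changes sign from each
    node of a line to the next; one strict inequality on the line then forces
    w = 0 there ([tridiag_positive_definite]).  A positive definite operator is
    injective on a finite-dimensional space, hence bijective
    ([tridiag_nonsingular]).

    For the nodal coefficient, the hypothesis of the first claim says exactly
    that c_i <= beta_i ([dominanceE]), so that s_k is even positive definite.
    For the harmonic one, beta_i = 5 (alpha_i + alpha_(i+e_k)) exceeds c_i at
    every node ([beta_harmonic]). *)

(** * Neighbours on the mesh *)

Section Mesh.
Variables (n : nat) (N : 'I_n -> nat) (k : 'I_n).
Implicit Types i j : node N.

Lemma inner_nodesP i :
  reflect (forall l, (1 <= i l <= (N l).-1)%N) (i \in inner_nodes N).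
Proof. by rewrite inE; exact: forallP. Qed.

Lemma inner_node_bounds i : i \in inner_nodes N -> (0 < i k < N k)%N.
Proof. by move=> /inner_nodesP/(_ k); lia. Qed.

Lemma node_predE i l : node_pred k i l = (i l - (l == k))%N :> nat.
Proof. by rewrite ffunE inordK//; have := ltn_ord (i l); lia. Qed.

Lemma node_succE i l : (i k < N k)%N ->
  node_succ k i l = (i l + (l == k))%N :> nat.
Proof.
move=> ik; rewrite ffunE inordK//.
by case: (eqVneq l k) => [->|_]; [lia|have := ltn_ord (i l); lia].
Qed.

Lemma node_succK i : (i k < N k)%N -> node_pred k (node_succ k i) = i.
Proof.
move=> ik; apply/ffunP => l; apply: ord_inj.
by rewrite node_predE node_succE// addnK.
Qed.

Lemma node_predK i : (0 < i k)%N -> node_succ k (node_pred k i) = i.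
Proof.
move=> ik; have ikN : (node_pred k i k < N k)%N.
  by rewrite node_predE eqxx; have := ltn_ord (i k); lia.
apply/ffunP => l; apply: ord_inj; rewrite node_succE// node_predE.
by case: (eqVneq l k) => [->|_]; rewrite ?subn0 ?addn0 ?subnK.
Qed.

Lemma node_pred_inner i : i \in inner_nodes N ->
  (node_pred k i \in inner_nodes N) = (nat_of_ord (i k) != 1%N).
Proof.
move=> /inner_nodesP iP; apply/inner_nodesP/idP => [/(_ k)|ik1 l].
  by rewrite node_predE eqxx; lia.
by rewrite node_predE; have := iP l; case: (eqVneq l k) => [->|_]; lia.
Qed.

Lemma node_succ_inner i : i \in inner_nodes N ->
  (node_succ k i \in inner_nodes N) = (nat_of_ord (i k) != (N k).-1).
Proof.
move=> iin; have /andP[_ ikN] := inner_node_bounds iin.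
move/inner_nodesP : iin => iP; apply/inner_nodesP/idP => [/(_ k)|ik1 l].
  by rewrite node_succE// eqxx; lia.
by rewrite node_succE//; have := iP l; case: (eqVneq l k) => [->|_]; lia.
Qed.

(** An edge between two inner nodes can be indexed by its upper or by its lower
    end. *)
Lemma sum_inner_edges (V : nmodType) (G : node N -> node N -> V) :
  \sum_(i in inner_nodes N | node_pred k i \in inner_nodes N) G (node_pred k i) i
  = \sum_(j in inner_nodes N | node_succ k j \in inner_nodes N)
      G j (node_succ k j).
Proof.
rewrite (reindex_onto (node_succ k) (node_pred k)); last first.
  move=> i /andP[iin _].
  by apply: node_predK; case/andP: (inner_node_bounds iin).
have succK j : j \in inner_nodes N -> node_pred k (node_succ k j) = j.
  by move=> /inner_node_bounds/andP[_]; exact: node_succK.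
apply: eq_big => [j|j /andP[_ /eqP ->]//].
apply/andP/andP => [[/andP[h1 h2] /eqP h3]|[h1 h2]]; first by rewrite -{1}h3.
by rewrite succK// eqxx h1 h2.
Qed.

(** The inner nodes of a mesh line are linked by steps through inner nodes, so a
    property that crosses each such step is constant on the line. *)
Lemma line_connected (P : node N -> Prop) :
  (forall i, i \in inner_nodes N -> node_pred k i \in inner_nodes N ->
     P i <-> P (node_pred k i)) ->
  forall i j, i \in inner_nodes N -> j \in inner_nodes N ->
  (forall l, l != k -> j l = i l) -> P i <-> P j.
Proof.
move=> step.
(* Upward induction on the distance; the other order of i and j is symmetric. *)
have H d i j : i \in inner_nodes N -> j \in inner_nodes N ->
    (forall l, l != k -> j l = i l) -> (i k + d)%N = j k -> P i <-> P j.
  elim: d j => [|d IH] j iin jin eqij jk.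
    suff -> : i = j by [].
    apply/ffunP => l; case: (eqVneq l k) => [->|/eqij//].
    by apply: ord_inj; rewrite -jk addn0.
  have pin : node_pred k j \in inner_nodes N.
    by rewrite node_pred_inner//; have := inner_node_bounds iin; lia.
  apply: iff_trans (iff_sym (step j jin pin)).
  apply: IH => //; last by rewrite node_predE eqxx; lia.
  move=> l lk; rewrite -eqij//; apply: ord_inj.
  by rewrite node_predE (negbTE lk) subn0.
move=> i j iin jin eqij; case: (leqP (i k) (j k)) => ij.
  by apply: (H (j k - i k)%N) => //; lia.
apply: iff_sym; apply: (H (i k - j k)%N) => //; last by lia.
by move=> l lk; rewrite eqij.
Qed.

End Mesh.

(** * Symmetric tridiagonal operators *)

Section Tridiagonal.
Variables (R : realType) (n : nat) (N : 'I_n -> nat) (k : 'I_n).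
Variables (X : 'I_n -> R).
Implicit Types (a b : node N -> R) (w z : {ffun node N -> R}).

(** The entry [a i] sits on the edge below i and is used from both of its ends,
    which builds the symmetry into the definition. *)
Definition tridiag a b w : {ffun node N -> R} :=
  [ffun i => if i \in inner_nodes N then
     a i * w (node_pred k i) + b i * w i + a (node_succ k i) * w (node_succ k i)
   else 0].

Lemma HhP w :
  reflect (forall i, i \notin inner_nodes N -> w i = 0) (w \in @Hh R n N).
Proof.
rewrite inE; apply: (iffP forallP) => [H i ni|H i].
  by apply/eqP; have := H i; rewrite ni.
by apply/implyP => /H ->.
Qed.

Lemma tridiag_Hh a b w : tridiag a b w \in @Hh R n N.
Proof. by apply/HhP => i /negbTE ni; rewrite ffunE ni. Qed.

Lemma sum_inner_mask (Q : pred (node N)) (F : node N -> R) :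
  (forall i, i \in inner_nodes N -> ~~ Q i -> F i = 0) ->
  \sum_(i in inner_nodes N) F i = \sum_(i in inner_nodes N | Q i) F i.
Proof.
move=> F0; rewrite (bigID Q)/= [X in _ + X]big1 ?addr0// => i /andP[].
exact: F0.
Qed.

(** Edges with an end on the boundary contribute nothing, so the sum may be
    restricted to inner edges and indexed by their lower end instead. *)
Lemma sum_edge_shift a w z : w \in @Hh R n N -> z \in @Hh R n N ->
  \sum_(i in inner_nodes N) a i * w (node_pred k i) * z i =
  \sum_(j in inner_nodes N) a (node_succ k j) * w j * z (node_succ k j).
Proof.
move=> /HhP w0 /HhP z0.
rewrite (sum_inner_mask (Q := fun i => node_pred k i \in inner_nodes N));
  last first.
  by move=> i _ /w0 ->; rewrite mulr0 mul0r.
rewrite (sum_inner_edges k (fun i j => a j * w i * z j)).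
rewrite -(sum_inner_mask (Q := fun i => node_succ k i \in inner_nodes N))//.
by move=> i _ /z0 ->; rewrite mulr0.
Qed.

Lemma tridiag_self_adjoint a b : self_adjoint X (tridiag a b).
Proof.
split=> [w _|w z win zin]; first exact: tridiag_Hh.
rewrite /inner -!mulr_suml; congr (_ * _).
have expand u v : \sum_(i in inner_nodes N) tridiag a b u i * v i =
    \sum_(i in inner_nodes N) a i * u (node_pred k i) * v i
    + \sum_(i in inner_nodes N) b i * u i * v i
    + \sum_(i in inner_nodes N) a (node_succ k i) * u (node_succ k i) * v i.
  by rewrite -!big_split; apply: eq_bigr => i iin; rewrite ffunE iin /=; ring.
under [RHS]eq_bigr do rewrite mulrC.
rewrite !expand [X in X + _ + _ = _]sum_edge_shift//.
rewrite [X in _ = X + _ + _]sum_edge_shift//.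
rewrite addrAC [RHS]addrAC [in RHS](addrC (\sum_(_ in _) _)).
congr (_ + _); last by apply: eq_bigr => i _; ring.
by congr (_ + _); apply: eq_bigr => i _; ring.
Qed.

Definition off_diag_sum a i : R :=
  (node_pred k i \in inner_nodes N)%:R * a i
  + (node_succ k i \in inner_nodes N)%:R * a (node_succ k i).

(** Completing the square on each inner edge takes [a] from the diagonal entry
    of both of its ends, in total [off_diag_sum a i] at i.  The square is
    that of the sum, not of the difference, so that positive [a] gives
    nonnegative terms. *)
Lemma tridiag_form a b w : w \in @Hh R n N ->
  \sum_(i in inner_nodes N) tridiag a b w i * w i =
  \sum_(i in inner_nodes N) (b i - off_diag_sum a i) * w i ^+ 2
  + \sum_(i in inner_nodes N | node_pred k i \in inner_nodes N)
      a i * (w (node_pred k i) + w i) ^+ 2.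
Proof.
move=> win; have w0 := HhP _ win.
have shift := sum_edge_shift a win win.
have shift2 : \sum_(i in inner_nodes N) (node_pred k i \in inner_nodes N)%:R
      * (a i * w (node_pred k i) ^+ 2) =
    \sum_(i in inner_nodes N) (node_succ k i \in inner_nodes N)%:R
      * (a (node_succ k i) * w i ^+ 2).
  under eq_bigr do rewrite mulr_natl mulrb.
  under [RHS]eq_bigr do rewrite mulr_natl mulrb.
  by rewrite -!big_mkcondr (sum_inner_edges k (fun i j => a j * w i ^+ 2)).
have -> : \sum_(i in inner_nodes N | node_pred k i \in inner_nodes N)
      a i * (w (node_pred k i) + w i) ^+ 2 =
    \sum_(i in inner_nodes N) (node_pred k i \in inner_nodes N)%:R
      * (a i * w (node_pred k i) ^+ 2)
    + \sum_(i in inner_nodes N) (node_pred k i \in inner_nodes N)%:R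
      * (a i * w i ^+ 2)
    + (\sum_(i in inner_nodes N) a i * w (node_pred k i) * w i +
       \sum_(i in inner_nodes N) a i * w (node_pred k i) * w i).
  rewrite big_mkcondr -!big_split; apply: eq_bigr => i _ /=.
  by case: ifPn => [_|/w0 ->] /=; ring.
rewrite {2}shift shift2 -!big_split; apply: eq_bigr => i iin.
by rewrite ffunE iin /off_diag_sum /=; ring.
Qed.

(** If the form vanishes at w, the edge terms make [w] alternate in sign along
    every line, while a strictly dominant node of the line has [w = 0]. *)
Lemma tridiag_positive_definite a b :
  (forall l, 0 < mesh_step X N l) ->
  (forall i, i \in inner_nodes N -> 0 < a i) ->
  (forall i, i \in inner_nodes N -> off_diag_sum a i <= b i) ->
  (forall i, i \in inner_nodes N -> exists j, [/\ j \in inner_nodes N,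
     forall l, l != k -> j l = i l & off_diag_sum a j < b j]) ->
  positive_definite X (tridiag a b).
Proof.
move=> h_gt0 a_gt0 dom strict w win wn0.
rewrite /inner -mulr_suml mulr_gt0//; last by apply: prodr_gt0 => l _.
rewrite tridiag_form//.
have diag_ge0 i : i \in inner_nodes N -> 0 <= (b i - off_diag_sum a i) * w i ^+ 2.
  by move=> iin; rewrite mulr_ge0 ?sqr_ge0// subr_ge0 dom.
have edge_ge0 i : (i \in inner_nodes N) && (node_pred k i \in inner_nodes N) ->
    0 <= a i * (w (node_pred k i) + w i) ^+ 2.
  by move=> /andP[iin _]; rewrite mulr_ge0 ?sqr_ge0// ltW// a_gt0.
rewrite lt_neqAle addr_ge0 ?sumr_ge0// andbT eq_sym.
rewrite paddr_eq0 ?sumr_ge0//.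
apply: contra wn0 => /andP[/eqP diag0 /eqP edge0].
have {}diag0 i : i \in inner_nodes N -> off_diag_sum a i < b i -> w i = 0.
  move=> iin lt; have /eqP := psumr_eq0P diag_ge0 diag0 iin.
  by rewrite mulf_eq0 sqrf_eq0 subr_eq0 gt_eqF//= => /eqP.
have {}edge0 i : i \in inner_nodes N -> node_pred k i \in inner_nodes N ->
    w (node_pred k i) = - w i.
  move=> iin pin; have := psumr_eq0P edge_ge0 edge0.
  move=> /(_ i); rewrite iin pin => /(_ isT)/eqP.
  by rewrite mulf_eq0 sqrf_eq0 gt_eqF ?a_gt0//= addr_eq0 => /eqP.
apply/eqP/ffunP => i; rewrite ffunE.
have [iin|iout] := boolP (i \in inner_nodes N); last exact: (HhP _ win).
have [j [jin eqij lt]] := strict i iin.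
apply: (proj2 (line_connected (P := fun i => w i = 0) _ iin jin eqij)).
  move=> i' iin' pin'; rewrite edge0//.
  by split=> [->|/eqP]; rewrite ?oppr0// oppr_eq0 => /eqP.
exact: diag0.
Qed.

(** Injectivity gives surjectivity by finite dimension, once the operator is
    extended from grid functions vanishing on the boundary to all of them. *)
Lemma tridiag_nonsingular a b :
  positive_definite X (tridiag a b) -> nonsingular (tridiag a b).
Proof.
move=> pos; split=> [w _|z zin]; first exact: tridiag_Hh.
(* The identity on boundary values makes the extension injective; [R^o] is the
   vector space structure on R that turns grid functions into vectors. *)
pose f (w : {ffun node N -> R^o}) : {ffun node N -> R^o} :=
  [ffun i => if i \in inner_nodes N then tridiag a b w i else w i].
have f_linear : linear f.
  move=> c u v; apply/ffunP => i; rewrite !ffunE; case: ifPn => [iin|//].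
  by rewrite iin /GRing.scale /=; ring.
pose fL := GRing.isLinear.Build _ _ _ _ f f_linear.
pose f' : {linear {ffun node N -> R^o} -> {ffun node N -> R^o}} :=
  HB.pack f fL.
have fHh w : w \in @Hh R n N -> f w = tridiag a b w.
  move=> /HhP w0; apply/ffunP => i; rewrite !ffunE.
  by have [//|iout] := boolP (i \in inner_nodes N); rewrite w0.
have f_ker w : f w = 0 -> w = 0.
  move=> fw0; have win : w \in @Hh R n N.
    by apply/HhP => i /negbTE ni; move/ffunP/(_ i) : fw0; rewrite !ffunE ni.
  apply/eqP; apply: contraT => wn0.
  have := pos w win wn0; rewrite -fHh// fw0 /inner big1 ?ltxx// => i _.
  by rewrite ffunE !mul0r.
have f_lker : lker (linfun f') == 0%VS.
  rewrite -subv0; apply/subvP => w; rewrite memv_ker memv0 lfunE => /eqP/f_ker.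
  by move=> ->.
have [w fw] : exists w, f w = z.
  by exists ((linfun f')^-1%VF z); rewrite -[f _](lfunE f') lker0_lfunVK.
have win : w \in @Hh R n N.
  apply/HhP => i ni; rewrite -((HhP _ zin) i ni) -fw ffunE.
  by rewrite (negbTE ni).
exists w; split; first by rewrite -fHh.
move=> v [vin vz]; apply/eqP; rewrite -subr_eq0; apply/eqP/f_ker.
by rewrite [LHS](linearB f' w v) /= fw fHh// vz subrr.
Qed.

End Tridiagonal.

(** * Positivity of the mean values *)

Section MeanValues.
Variables (R : realType) (n : nat) (X : 'I_n -> R) (N : 'I_n -> nat).
Hypothesis X_gt0 : forall l, 0 < X l.
Hypothesis N_gt0 : forall l, (0 < N l)%N.

Lemma mesh_step_gt0 l : 0 < mesh_step X N l.
Proof. by rewrite divr_gt0// ltr0n. Qed.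

Lemma grid_coord_bounds (m : nat) l : (m <= N l)%N ->
  0 <= m%:R * mesh_step X N l <= X l.
Proof.
move=> mN; rewrite mulr_ge0 ?ler0n ?(ltW (mesh_step_gt0 l))//=.
have -> : X l = (N l)%:R * mesh_step X N l.
  by rewrite /mesh_step mulrCA divff ?mulr1// pnatr_eq0 -lt0n.
by rewrite ler_wpM2r ?(ltW (mesh_step_gt0 l))// ler_nat.
Qed.

Lemma node_point_in_box (i : node N) : closed_box X (node_point X i).
Proof. by move=> l; rewrite mxE grid_coord_bounds// -ltnS. Qed.

Lemma grid_line_in_box (k : 'I_n) (i : node N) t : 0 <= t <= X k ->
  closed_box X (set_coord (node_point X i) k t).
Proof.
move=> tX l; rewrite !mxE; case: eqP => [->//|_].
by apply: grid_coord_bounds; rewrite -ltnS.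
Qed.

Lemma set_coord_continuous (x : 'rV[R]_n) (k : 'I_n) :
  continuous (fun t : R => set_coord x k t).
Proof.
have -> : (fun t : R => set_coord x k t) =
    (fun t => set_coord x k 0 + t *: delta_mx ord0 k).
  apply/funext => t; apply/rowP => l; rewrite !mxE /=.
  by case: eqP => _ /=; ring.
by move=> t; apply: cvgD; [exact: cvg_cst|apply: cvgZr_tmp; exact: cvg_id].
Qed.

(** The minimum of f on the segment is attained, hence positive, and bounds the
    mean of f from below. *)
Lemma Rintegral_gt0 (f : R -> R) (a b : R) : a < b ->
  {within `[a, b], continuous f} -> (forall t, a <= t <= b -> 0 < f t) ->
  0 < \int[lebesgue_measure]_(t in `[a, b]) f t.
Proof.
move=> ab fc f_gt0.
have [c cab fmin] := EVT_min (ltW ab) fc.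
have fc_gt0 : 0 < f c by apply: f_gt0; move: cab; rewrite in_itv.
have meas : measurable (`[a, b] : set R) by exact: measurable_itv.
apply: (@lt_le_trans _ _ (f c * (b - a))); first by rewrite mulr_gt0// subr_gt0.
have -> : f c * (b - a) = \int[lebesgue_measure]_(t in `[a, b]) (fun=> f c) t.
  rewrite Rintegral_cst//; congr (_ * _).
  by rewrite [X in fine X]lebesgue_measure_itv/= lte_fin ab.
apply: (@le_Rintegral _ _ R lebesgue_measure _ (fun=> f c) f) => //.
- apply: continuous_compact_integrable; first exact: segment_compact.
  by apply: continuous_subspaceT => x; exact: cvg_cst.
- by apply: continuous_compact_integrable; first exact: segment_compact.
Qed.

(** The upper bound keeps both Gauss points within the mesh cell. *)
Lemma theta_G_bounds : 0 <= theta_G R <= 1 / 2.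
Proof.
have s1 : 1 <= Num.sqrt (3 : R) by rewrite -{1}sqrtr1 ler_sqrt//; lra.
rewrite /theta_G divr_ge0//=.
by rewrite !div1r lef_pV2 ?posrE; lra.
Qed.

Variable sigma : 'rV[R]_n -> R.
Hypothesis sigma_cont : {within closed_box X, continuous sigma}.
Hypothesis sigma_gt0 : forall x, closed_box X x -> 0 < sigma x.

(** Every mean value samples sigma with positive weights on the segment from
    x_(i - e_k) to x_i, which lies in the closed box. *)
Lemma hat_gt0 (m : mean_kind) (k : 'I_n) (i : node N) :
  (0 < i k)%N -> 0 < hat X sigma m k i.
Proof.
move=> ik0; have ikN : (i k <= N k)%N by rewrite -ltnS.
set h := mesh_step X N k; have h0 : 0 < h := mesh_step_gt0 k.
pose line t := set_coord (node_point X i) k t.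
have seg_box t : ((i k)%:R - 1) * h <= t <= (i k)%:R * h -> 0 <= t <= X k.
  move=> /andP[t1 t2]; have /andP[_ top] := grid_coord_bounds ikN.
  rewrite (le_trans t2 top) andbT (le_trans _ t1)//.
  by rewrite mulr_ge0 ?(ltW h0)// subr_ge0 ler1n.
have line_box t :
    ((i k)%:R - 1) * h <= t <= (i k)%:R * h -> closed_box X (line t).
  by move=> /seg_box; exact: grid_line_in_box.
have sline t : ((i k)%:R - 1) * h <= t <= (i k)%:R * h -> 0 < sigma (line t).
  by move=> /line_box; exact: sigma_gt0.
(* Position s is measured in mesh steps from the node i. *)
have shift s : -1 <= s <= 0 -> 0 < sigma (line (((i k)%:R + s) * h)).
  by move=> /andP[s1 s2]; apply: sline; rewrite !ler_pM2r// lerD2l s1/=; lra.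
have node0 : node_point X i = line (((i k)%:R + 0) * h).
  by apply/rowP => l; rewrite !mxE addr0; case: eqP => // ->.
have pointE s : node_point X i + (s * h) *: delta_mx ord0 k
    = line (((i k)%:R + s) * h).
  by apply/rowP => l; rewrite !mxE /=; case: eqP => [->|_] /=; rewrite /h; ring.
case: m; rewrite /hat -/h /half_point -/h.
- rewrite pmulr_rgt0; last by rewrite div1r invr_gt0.
  apply: (@Rintegral_gt0 (fun t => sigma (line t))).
  + by rewrite ltr_pM2r// ltrBlDr ltrDl.
  + apply/subspace_continuousP => t tab.
    move/subspace_continuousP : sigma_cont => /(_ (line t)) sc.
    have lt : closed_box X (line t).
      by apply: line_box; move: tab; rewrite /= in_itv.
    move=> P /= /(sc lt) nP.
    have near_t : \forall u \near t, closed_box X (line u) -> P (sigma (line u)).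
      exact: (set_coord_continuous (x := node_point X i) (k := k) nP).
    apply: (@filterS _ (nbhs t) _ _ _ _ near_t) => u Pu /= uab.
    by apply/Pu/line_box; move: uab; rewrite in_itv.
  + exact: sline.
- have nodeP : node_point X (node_pred k i) = line (((i k)%:R - 1) * h).
    apply/rowP => l; rewrite !mxE node_predE; case: eqP => [->|_] /=.
      by rewrite natrB.
    by rewrite subn0.
  have -> : node_point X i - (h / 2) *: delta_mx ord0 k
      = line (((i k)%:R - 1 / 2) * h).
    by rewrite -pointE; apply/rowP => l; rewrite !mxE; ring.
  rewrite nodeP node0.
  have := shift (-1); have := shift (- (1 / 2)); have := shift 0.
  by move=> H1 H2 H3; rewrite mulr_gt0//; have := H1; lra.
- have /andP[th0 th1] := theta_G_bounds.
  have -> : node_point X i - (h / 2) *: delta_mx ord0 k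
        - (theta_G R * h) *: delta_mx ord0 k
      = line (((i k)%:R + (- (1 / 2) - theta_G R)) * h).
    by rewrite -pointE; apply/rowP => l; rewrite !mxE; ring.
  have -> : node_point X i - (h / 2) *: delta_mx ord0 k
        + (theta_G R * h) *: delta_mx ord0 k
      = line (((i k)%:R + (- (1 / 2) + theta_G R)) * h).
    by rewrite -pointE; apply/rowP => l; rewrite !mxE; ring.
  by rewrite mulr_gt0 ?addr_gt0// ?divr_gt0//; apply: shift; lra.
Qed.

(** * The operator s_k as a tridiagonal operator *)

Variables (k : 'I_n) (m : mean_kind).

Lemma alpha_gt0 (i : node N) : (0 < i k)%N -> 0 < alpha X sigma m k i.
Proof. by move=> /hat_gt0 h; rewrite divr_gt0// mulr_gt0. Qed.

Lemma s_op_tridiag c :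
  @s_op R n X N sigma m c k =
  tridiag k (@alpha R n X N sigma m k) (@beta R n X N sigma m c k).
Proof.
apply/funext => w; apply/ffunP => i; rewrite !ffunE; case: ifP => // _.
have : mesh_step X N k != 0 by rewrite gt_eqF ?mesh_step_gt0.
rewrite /beta /alpha /Lambda; move: (mesh_step X N k) => h h0; rewrite !invfM.
set p := (hat _ _ _ _ i)^-1; set q := (hat _ _ _ _ _)^-1.
set r := 1 / coef _ _ _ _ _ _.
by field.
Qed.

Lemma beta_harmonic (i : node N) :
  beta X sigma m CoefHarmonic k i
  = 5 * (alpha X sigma m k i + alpha X sigma m k (node_succ k i)).
Proof.
rewrite /beta /alpha /coef div1r invrK !invfM.
by set p := (hat _ _ _ _ i)^-1; set q := (hat _ _ _ _ _)^-1; field.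
Qed.

(** Of the two copies of an off-diagonal entry, one comes from beta and the other
    from [off_diag_sum]; the Kronecker symbol removes the latter when the
    neighbour lies on the boundary. *)
Lemma dominanceE (i : node N) : i \in inner_nodes N ->
  dominance X sigma m k i = 1 - sigma (node_point X i) *
    (beta X sigma m CoefNodal k i - off_diag_sum k (@alpha R n X N sigma m k) i).
Proof.
move=> iin; have s0 : sigma (node_point X i) != 0.
  by rewrite gt_eqF//; apply/sigma_gt0/node_point_in_box.
rewrite /dominance /off_diag_sum /beta /coef /alpha !invfM.
rewrite node_pred_inner// node_succ_inner//.
set p := (hat _ _ _ _ i)^-1; set q := (hat _ _ _ _ _)^-1.
by do 2 case: eqP => _ /=; field.
Qed.

End MeanValues.

Theorem proposition2 (R : realType) (n : nat) (n_ge1 : (1 <= n)%N)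
    (X : 'I_n -> R) (X_gt0 : forall l, 0 < X l)
    (N : 'I_n -> nat) (N_ge2 : forall l, (2 <= N l)%N)
    (sigma : 'rV[R]_n -> R)
    (sigma_smooth : smooth_on_closed_box X sigma)
    (sigma_gt0 : forall x, closed_box X x -> 0 < sigma x)
    (k : 'I_n) (m : mean_kind) :
  [/\ forall c : coef_kind, self_adjoint X (@s_op R n X N sigma m c k),
      (forall i : node N, i \in inner_nodes N -> dominance X sigma m k i <= 1) ->
      (forall i : node N, i \in inner_nodes N ->
         exists j : node N, [/\ j \in inner_nodes N,
           forall l, l != k -> j l = i l & dominance X sigma m k j < 1]) ->
      nonsingular (@s_op R n X N sigma m CoefNodal k)
    & [/\ forall i : node N, i \in inner_nodes N ->
            beta X sigma m CoefHarmonic k i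
            = 5 * (alpha X sigma m k i + alpha X sigma m k (node_succ k i)),
          positive_definite X (@s_op R n X N sigma m CoefHarmonic k)
        & nonsingular (@s_op R n X N sigma m CoefHarmonic k)]].
Proof.
have N_gt0 l : (0 < N l)%N by exact: ltnW.
have sigma_cont : {within closed_box X, continuous sigma}.
  by case: sigma_smooth => D [<- Dc _]; exact: Dc.
have sE := s_op_tridiag X_gt0 N_gt0 sigma k m.
have step_gt0 := mesh_step_gt0 X_gt0 N_gt0.
have a_gt0 (i : node N) : (0 < i k)%N -> 0 < alpha X sigma m k i.
  exact: alpha_gt0.
have a_inner (i : node N) : i \in inner_nodes N -> 0 < alpha X sigma m k i.
  by move=> /(inner_node_bounds k)/andP[+ _]; exact: a_gt0.
split=> [c|dom strict|]; first by rewrite sE; exact: tridiag_self_adjoint.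
- have node_gt0 (i : node N) : 0 < sigma (node_point X i).
    by apply: sigma_gt0; exact: node_point_in_box.
  rewrite sE; apply: (tridiag_nonsingular (X := X)).
  apply: tridiag_positive_definite => // i iin.
    have := dom i iin; rewrite (dominanceE X_gt0 N_gt0 sigma_gt0)//.
    by rewrite gerBl pmulr_rge0// subr_ge0.
  have [j [jin eqij]] := strict i iin.
  rewrite (dominanceE X_gt0 N_gt0 sigma_gt0)// gtrBl pmulr_rgt0// subr_gt0.
  by exists j.
- have pos : positive_definite X (@s_op R n X N sigma m CoefHarmonic k).
    rewrite sE; have lt (i : node N) : i \in inner_nodes N ->
        off_diag_sum k (@alpha R n X N sigma m k) i
        < beta X sigma m CoefHarmonic k i.
      move=> iin; rewrite beta_harmonic /off_diag_sum.
      have /andP[_ ikN] := inner_node_bounds k iin.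
      have := a_inner _ iin; have : 0 < alpha X sigma m k (node_succ k i).
        by apply: a_gt0; rewrite node_succE// eqxx addn1.
      by do 2 case: (_ \in _); rewrite ?mul1r ?mul0r; lra.
    apply: tridiag_positive_definite => // [i /lt/ltW//|i iin].
    by exists i; split=> //; exact: lt.
  split=> //; first by move=> i _; exact: beta_harmonic.
  by move: pos; rewrite sE; exact: tridiag_nonsingular.
Qed.
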